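(* If $n=2\nu$ is even, then $M\in\mathbb{R}^{n\times n}$ is an element of $R_n$ if and only if $$M=\mathcal{X}_n\begin{pmatrix}\gamma\mathcal{E}_\nu&1_\nu z^T\\ x1_\nu^T&Z\end{pmatrix}\mathcal{X}_n$$ for some $Z\in\mathbb{R}^{\nu\times\nu}$, $x,z\in\mathbb{R}^\nu$ and $\gamma\in\mathbb{R}$. If $n=2\nu+1$ is odd, then $M\in\mathbb{R}^{n\times n}$ is an element of $R_n$ if and only if $$M=\mathcal{X}_n\begin{pmatrix}\sqrt2\,\gamma\mathcal{E}_\nu&\gamma1_\nu&\sqrt2\,1_\nu z^T\\ \gamma1_\nu^T&\frac{\gamma}{\sqrt2}&z^T\\ \sqrt2\,x1_\nu^T&x&Z\end{pmatrix}\mathcal{X}_n$$ for some $Z\in\mathbb{R}^{\nu\times\nu}$, $x,z\in\mathbb{R}^\nu$ and $\gamma\in\mathbb{R}$.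
   Context: $R_n$ is the space of matrices $M\in\mathbb{R}^{n\times n}$ such that $M_{i,j}+M_{i,n+1-j}=M_{i,k}+M_{i,n+1-k}$ and $M_{i,j}+M_{n+1-i,j}=M_{k,j}+M_{n+1-k,j}$ for all $i,j,k\in\{1,\dots,n\}$. $1_\nu$ and $0_\nu$ are the all-ones and null column vectors in $\mathbb{R}^\nu$; $\mathcal{E}_\nu$ is the $\nu\times\nu$ matrix with all entries $1$; $\mathcal{I}_\nu$ is the $\nu\times\nu$ unit matrix; $\mathcal{J}_\nu=(\delta_{i,\nu+1-j})_{i,j=1}^\nu$ (ones on the antidiagonal, zeros elsewhere); and $$\mathcal{X}_n=\frac1{\sqrt2}\begin{pmatrix}\mathcal{I}_\nu&\mathcal{J}_\nu\\ \mathcal{J}_\nu&-\mathcal{I}_\nu\end{pmatrix}\ (n=2\nu),\qquad \mathcal{X}_n=\begin{pmatrix}\frac1{\sqrt2}\mathcal{I}_\nu&0_\nu&\frac1{\sqrt2}\mathcal{J}_\nu\\ 0_\nu^T&1&0_\nu^T\\ \frac1{\sqrt2}\mathcal{J}_\nu&0_\nu&-\frac1{\sqrt2}\mathcal{I}_\nu\end{pmatrix}\ (n=2\nu+1).$$ *)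

(* Defs.v *)
From mathcomp Require Import all_boot all_order all_algebra.
From mathcomp Require Import reals.

Set Implicit Arguments.
Unset Strict Implicit.
Unset Printing Implicit Defensive.

Import Order.TTheory GRing.Theory Num.Theory.
Local Open Scope ring_scope.

(* Indices are 0-based, so [rev_ord j] is the 1-based index n + 1 - j. *)
Definition in_Rn (R : realType) (n : nat) (M : 'M[R]_n) : Prop :=
  forall i j k : 'I_n,
    M i j + M i (rev_ord j) = M i k + M i (rev_ord k) /\
    M i j + M (rev_ord i) j = M k j + M (rev_ord k) j.

Definition ones (R : realType) (nu : nat) : 'cV[R]_nu := const_mx 1.

Definition Emx (R : realType) (nu : nat) : 'M[R]_nu := const_mx 1.

Definition Jmx (R : realType) (nu : nat) : 'M[R]_nu :=
  \matrix_(i, j) (i == rev_ord j)%:R.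

Definition sqrt2 (R : realType) : R := Num.sqrt 2.

Definition block3_mx (R : realType) (m1 m2 m3 n1 n2 n3 : nat)
    (A11 : 'M[R]_(m1, n1)) (A12 : 'M[R]_(m1, n2)) (A13 : 'M[R]_(m1, n3))
    (A21 : 'M[R]_(m2, n1)) (A22 : 'M[R]_(m2, n2)) (A23 : 'M[R]_(m2, n3))
    (A31 : 'M[R]_(m3, n1)) (A32 : 'M[R]_(m3, n2)) (A33 : 'M[R]_(m3, n3)) :
    'M[R]_(m1 + (m2 + m3), n1 + (n2 + n3)) :=
  block_mx A11 (row_mx A12 A13)
           (col_mx A21 A31) (block_mx A22 A23 A32 A33).

(* The matrix X_n for n = 2 nu. *)
Definition Xeven (R : realType) (nu : nat) : 'M[R]_(nu + nu) :=
  (sqrt2 R)^-1 *: block_mx 1%:M (Jmx R nu)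
                           (Jmx R nu) (- 1%:M).

(* The matrix X_n for n = 2 nu + 1; the middle block has size 1. *)
Definition Xodd (R : realType) (nu : nat) : 'M[R]_(nu + (1 + nu)) :=
  block3_mx
    ((sqrt2 R)^-1 *: 1%:M)        0     ((sqrt2 R)^-1 *: Jmx R nu)
    0                             1%:M  0
    ((sqrt2 R)^-1 *: Jmx R nu)    0     (- ((sqrt2 R)^-1 *: 1%:M)).

(* Main.v *)
(* Let J be the reversal matrix, 1 the all-ones vector, X = X_n. The row condition
   on M says that M (I + J) = r 1^T for some r. Since X is a symmetric
   involution with J X = X K, K = diag(I, -I) or diag(I, 1, -I), conjugation
   by X turns this into N (I + K) = r' (1^T X) for N = X M X, where
   1^T X = sqrt 2 (1^T, 0) or (sqrt 2 1^T, 1, 0). This constrains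
   every block column of N but the last; the column condition is the same one for N^T. *)
Require Import Defs.
From mathcomp Require Import all_boot all_order all_algebra.
From mathcomp Require Import reals.
From mathcomp Require Import zify lra.

Set Implicit Arguments.
Unset Strict Implicit.
Unset Printing Implicit Defensive.

Import Order.TTheory GRing.Theory Num.Theory.
Local Open Scope ring_scope.

Section RowPairs.
Variable R : realType.

(** * The pair-sum condition on rows and its conjugation by an involution *)

Definition row_pairs_const (n : nat) (M : 'M[R]_n) : Prop :=
  forall i j k : 'I_n, M i j + M i (rev_ord j) = M i k + M i (rev_ord k).

Lemma in_Rn_trmx (n : nat) (M : 'M[R]_n) :
  in_Rn M <-> row_pairs_const M /\ row_pairs_const M^T.
Proof.
split=> [H | [Hr Hc] i j k].
  by split=> i j k; [case: (H i j k) | rewrite !mxE; case: (H j i k)].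
by split; [exact: Hr | have := Hc j i k; rewrite !mxE].
Qed.

Lemma mulmx_Jmx (m n : nat) (A : 'M[R]_(m, n)) i j :
  (A *m Jmx R n) i j = A i (rev_ord j).
Proof.
rewrite mxE (bigD1 (rev_ord j)) //= mxE eqxx mulr1 big1 ?addr0 // => k.
by rewrite mxE => /negPf ->; rewrite mulr0.
Qed.

Lemma mulmx_ones_tr (m n : nat) (r : 'cV[R]_m) i j :
  (r *m (ones R n)^T) i j = r i 0.
Proof. by rewrite mxE big_ord1 !mxE mulr1. Qed.

Lemma row_pairs_constP (n : nat) (M : 'M[R]_n) :
  row_pairs_const M <->
  exists r : 'cV[R]_n, M *m (1%:M + Jmx R n) = r *m (ones R n)^T.
Proof.
have entry i j : (M *m (1%:M + Jmx R n)) i j = M i j + M i (rev_ord j).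
  by rewrite mulmxDr mulmx1 [LHS]mxE mulmx_Jmx.
split=> [H | [r Hr] i j k]; last by rewrite -!entry Hr !mulmx_ones_tr.
(* The witness is the pair sum at the first column, so size 0, which has no column, is treated
   apart. *)
case: n M entry H => [|n] M entry H; first by exists 0; apply/matrixP => -[].
exists (\col_i (M i ord0 + M i (rev_ord ord0))).
by apply/matrixP => i j; rewrite entry mulmx_ones_tr mxE.
Qed.

Lemma conj_involutive (n : nat) (X M N : 'M[R]_n) :
  X *m X = 1%:M -> M = X *m N *m X <-> X *m M *m X = N.
Proof.
by move=> XX; split=> [->|<-]; rewrite !mulmxA XX mul1mx -mulmxA XX mulmx1.
Qed.

(** Conjugation by [X] turns the reversal matrix into [K], so the left-hand product is the conjugate
    of [M *m (1%:M + Jmx R n)]. Being existentially quantified, [r] absorbs the left factor [X]. *)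
Lemma row_pairs_const_conj (n : nat) (X K M : 'M[R]_n) :
    X *m X = 1%:M -> Jmx R n *m X = X *m K ->
  row_pairs_const M <->
  exists r : 'cV[R]_n,
    X *m M *m X *m (1%:M + K) = r *m ((ones R n)^T *m X).
Proof.
move=> XX JX.
have conj : X *m M *m X *m (1%:M + K) = X *m (M *m (1%:M + Jmx R n)) *m X.
  by rewrite -!mulmxA mulmxDr mulmx1 -JX mulmxDl mul1mx.
rewrite row_pairs_constP; split=> -[r Hr].
  by exists (X *m r); rewrite conj Hr !mulmxA.
rewrite conj in Hr; move/(conj_involutive _ _ XX): Hr => ->.
by exists (X *m r); rewrite -!mulmxA XX mulmx1.
Qed.

(** Symmetry of [X] makes [N^T] the conjugate of [M^T], so the row criterion serves for columns too.
    Giving [N] by an equation allows a block decomposition in its place. *)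
Lemma in_Rn_conj (n : nat) (X K M N : 'M[R]_n) :
    X *m X = 1%:M -> X^T = X -> Jmx R n *m X = X *m K -> X *m M *m X = N ->
  in_Rn M <->
  (exists r : 'cV[R]_n, N *m (1%:M + K) = r *m ((ones R n)^T *m X)) /\
  (exists r : 'cV[R]_n, N^T *m (1%:M + K) = r *m ((ones R n)^T *m X)).
Proof.
move=> XX trX JX <-.
have -> : (X *m M *m X)^T = X *m M^T *m X by rewrite !trmx_mul trX mulmxA.
by rewrite in_Rn_trmx !(row_pairs_const_conj _ XX JX).
Qed.

(** * Identities for [sqrt2] and for the reversal matrix *)

Lemma sqrt2_neq0 : sqrt2 R != 0.
Proof. by rewrite /sqrt2 sqrtr_eq0 -ltNge ltr0n. Qed.

Lemma sqrt2_sqr : sqrt2 R * sqrt2 R = 2.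
Proof. by rewrite -expr2 sqr_sqrtr ?ler0n. Qed.

Lemma Jmx_tr (n : nat) : (Jmx R n)^T = Jmx R n.
Proof.
by apply/matrixP => i j; rewrite !mxE -(inj_eq rev_ord_inj) rev_ordK eq_sym.
Qed.

Lemma Jmx_mul (n : nat) : Jmx R n *m Jmx R n = 1%:M.
Proof. by apply/matrixP => i j; rewrite mulmx_Jmx !mxE rev_ordK. Qed.

Lemma ones_tr_Jmx (n : nat) : (ones R n)^T *m Jmx R n = (ones R n)^T.
Proof. by apply/matrixP => i j; rewrite mulmx_Jmx !mxE. Qed.

(** * Calculus of 3 by 3 block matrices *)

Lemma mul_block3 (m1 m2 m3 n1 n2 n3 p1 p2 p3 : nat)
    (A11 : 'M[R]_(m1, n1)) (A12 : 'M[R]_(m1, n2)) (A13 : 'M[R]_(m1, n3))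
    (A21 : 'M[R]_(m2, n1)) (A22 : 'M[R]_(m2, n2)) (A23 : 'M[R]_(m2, n3))
    (A31 : 'M[R]_(m3, n1)) (A32 : 'M[R]_(m3, n2)) (A33 : 'M[R]_(m3, n3))
    (B11 : 'M[R]_(n1, p1)) (B12 : 'M[R]_(n1, p2)) (B13 : 'M[R]_(n1, p3))
    (B21 : 'M[R]_(n2, p1)) (B22 : 'M[R]_(n2, p2)) (B23 : 'M[R]_(n2, p3))
    (B31 : 'M[R]_(n3, p1)) (B32 : 'M[R]_(n3, p2)) (B33 : 'M[R]_(n3, p3)) :
  block3_mx A11 A12 A13 A21 A22 A23 A31 A32 A33
  *m block3_mx B11 B12 B13 B21 B22 B23 B31 B32 B33 =
  block3_mx
    (A11 *m B11 + A12 *m B21 + A13 *m B31)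
    (A11 *m B12 + A12 *m B22 + A13 *m B32)
    (A11 *m B13 + A12 *m B23 + A13 *m B33)
    (A21 *m B11 + A22 *m B21 + A23 *m B31)
    (A21 *m B12 + A22 *m B22 + A23 *m B32)
    (A21 *m B13 + A22 *m B23 + A23 *m B33)
    (A31 *m B11 + A32 *m B21 + A33 *m B31)
    (A31 *m B12 + A32 *m B22 + A33 *m B32)
    (A31 *m B13 + A32 *m B23 + A33 *m B33).
Proof.
rewrite /block3_mx mulmx_block mul_row_block mul_block_col mul_mx_row mul_col_mx.
rewrite mul_row_col mulmx_block mul_col_row.
by rewrite add_row_mx add_col_mx add_block_mx !addrA.
Qed.

Lemma tr_block3 (m1 m2 m3 n1 n2 n3 : nat)
    (A11 : 'M[R]_(m1, n1)) (A12 : 'M[R]_(m1, n2)) (A13 : 'M[R]_(m1, n3))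
    (A21 : 'M[R]_(m2, n1)) (A22 : 'M[R]_(m2, n2)) (A23 : 'M[R]_(m2, n3))
    (A31 : 'M[R]_(m3, n1)) (A32 : 'M[R]_(m3, n2)) (A33 : 'M[R]_(m3, n3)) :
  (block3_mx A11 A12 A13 A21 A22 A23 A31 A32 A33)^T =
  block3_mx A11^T A21^T A31^T A12^T A22^T A32^T A13^T A23^T A33^T.
Proof. by rewrite /block3_mx !tr_block_mx tr_row_mx tr_col_mx. Qed.

Lemma block3_mx_exists (m1 m2 m3 n1 n2 n3 : nat)
    (A : 'M[R]_(m1 + (m2 + m3), n1 + (n2 + n3))) :
  exists A11 A12 A13 A21 A22 A23 A31 A32 A33,
    A = @block3_mx R m1 m2 m3 n1 n2 n3 A11 A12 A13 A21 A22 A23 A31 A32 A33.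
Proof.
exists (ulsubmx A), (lsubmx (ursubmx A)), (rsubmx (ursubmx A)).
exists (usubmx (dlsubmx A)), (ulsubmx (drsubmx A)), (ursubmx (drsubmx A)).
exists (dsubmx (dlsubmx A)), (dlsubmx (drsubmx A)), (drsubmx (drsubmx A)).
by rewrite /block3_mx !hsubmxK !vsubmxK !submxK.
Qed.

Lemma eq_block3_mx (m1 m2 m3 n1 n2 n3 : nat)
    (A11 B11 : 'M[R]_(m1, n1)) (A12 B12 : 'M[R]_(m1, n2))
    (A13 B13 : 'M[R]_(m1, n3))
    (A21 B21 : 'M[R]_(m2, n1)) (A22 B22 : 'M[R]_(m2, n2))
    (A23 B23 : 'M[R]_(m2, n3))
    (A31 B31 : 'M[R]_(m3, n1)) (A32 B32 : 'M[R]_(m3, n2))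
    (A33 B33 : 'M[R]_(m3, n3)) :
  block3_mx A11 A12 A13 A21 A22 A23 A31 A32 A33 =
  block3_mx B11 B12 B13 B21 B22 B23 B31 B32 B33 ->
  [/\ A11 = B11, A12 = B12 & A13 = B13] /\
  [/\ A21 = B21, A22 = B22 & A23 = B23] /\
  [/\ A31 = B31, A32 = B32 & A33 = B33].
Proof.
move=> /eq_block_mx[-> /eq_row_mx[-> ->] /eq_col_mx[-> ->]].
by move=> /eq_block_mx[-> -> -> ->].
Qed.

(** * Block forms of the reversal matrix *)

Variable nu : nat.
Let J := Jmx R nu.
Let s := (sqrt2 R)^-1.

Lemma invsqrt2_sqr : s * s + s * s = 1.
Proof. rewrite /s -invfM sqrt2_sqr; lra. Qed.

Lemma Jmx_even : Jmx R (nu + nu) = block_mx 0 J J 0.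
Proof.
apply/matrixP => i j; rewrite -(splitK i) -(splitK j).
case: (split i) => a; case: (split j) => b;
  rewrite /= ?(block_mxEul, block_mxEur, block_mxEdl, block_mxEdr) !mxE;
  rewrite -?val_eqE /=; have := ltn_ord a; have := ltn_ord b => *.
(* Two indices in the same half are never mirror images; across the halves, mirroring in size
   [nu + nu] amounts to mirroring in size [nu]. *)
- by case: eqP => //=; lia.
- by congr (nat_of_bool _)%:R; lia.
- by congr (nat_of_bool _)%:R; lia.
- by case: eqP => //=; lia.
Qed.

Lemma Jmx_odd : Jmx R (nu + (1 + nu)) = block3_mx 0 0 J 0 1%:M 0 J 0 0.
Proof.
apply/matrixP => i j; rewrite /block3_mx -(splitK i) -(splitK j).
case: (split i) => [a|a']; last (rewrite -(splitK a'); case: (split a') => a {a'});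
(case: (split j) => [b|b']; last (rewrite -(splitK b'); case: (split b') => b {b'}));
  rewrite /= ?(block_mxEul, block_mxEur, block_mxEdl, block_mxEdr,
    col_mxEu, col_mxEd, row_mxEl, row_mxEr) !mxE;
  rewrite -?val_eqE /=; have := ltn_ord a; have := ltn_ord b => *;
  by [case: eqP => //=; lia | congr (nat_of_bool _)%:R; lia].
Qed.

Lemma ones_add (m n : nat) : ones R (m + n) = col_mx (ones R m) (ones R n).
Proof. by rewrite /ones col_mx_const. Qed.

(** * Even size: the conjugating matrix and the admissible blocks *)

Lemma Xeven_sqr : Xeven R nu *m Xeven R nu = 1%:M.
Proof.
rewrite /Xeven -scalemxAl -scalemxAr scalerA mulmx_block.
rewrite !(mul1mx, mulmx1, mulmxN, mulNmx, opprK) Jmx_mul subrr.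
rewrite scale_block_mx !scaler0 -mulr2n -scaler_nat scalerA.
by rewrite mulr_natr mulr2n invsqrt2_sqr scale1r -scalar_mx_block.
Qed.

Lemma tr_Xeven : (Xeven R nu)^T = Xeven R nu.
Proof.
by rewrite /Xeven linearZ /= tr_block_mx linearN /= trmx1 Jmx_tr.
Qed.

(** The columns of [Xeven] are eigenvectors of the reversal: the first [nu] are symmetric, the last
    [nu] antisymmetric. The eigenvalues form the diagonal factor on the right. *)
Lemma Jmx_Xeven :
  Jmx R (nu + nu) *m Xeven R nu = Xeven R nu *m block_mx 1%:M 0 0 (- 1%:M).
Proof.
rewrite Jmx_even /J /Xeven -scalemxAl -scalemxAr !mulmx_block.
by rewrite !(mul1mx, mulmx1, mulmxN, mulNmx, opprK, mul0mx, mulmx0,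
  Jmx_mul, add0r, addr0, oppr0).
Qed.

(** A symmetric column has two nonzero entries [1 / sqrt2], with sum [sqrt2]; an antisymmetric one
    sums to 0. *)
Lemma ones_Xeven :
  (ones R (nu + nu))^T *m Xeven R nu = sqrt2 R *: row_mx (ones R nu)^T 0.
Proof.
rewrite ones_add tr_col_mx /Xeven -scalemxAr mul_row_block.
(* The zero block is rewritten as its own double so that the factor 2 comes out of the whole row. *)
rewrite !mulmxN !mulmx1 ones_tr_Jmx subrr -mulr2n -scaler_nat -[0 in LHS](scaler0 _ 2).
by rewrite -scale_row_mx scalerA -sqrt2_sqr mulKf ?sqrt2_neq0.
Qed.

(** The factor on the left is twice the projection onto the first block, and the row on the right
    vanishes on the second. So [B] and [D] stay free, and the scalars are absorbed into [r]. *)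
Lemma even_shape (A B C D : 'M[R]_nu) :
  (exists r : 'cV[R]_(nu + nu),
     block_mx A B C D *m (1%:M + block_mx 1%:M 0 0 (- 1%:M)) =
     r *m ((ones R (nu + nu))^T *m Xeven R nu)) <->
  (exists a c : 'cV[R]_nu, A = a *m (ones R nu)^T /\ C = c *m (ones R nu)^T).
Proof.
have -> : block_mx A B C D *m (1%:M + block_mx 1%:M 0 0 (- 1%:M)) =
          2 *: block_mx A 0 C 0.
  rewrite mulmxDr mulmx1 mulmx_block.
  rewrite !(mulmx1, mulmx0, mulmxN, addr0, add0r) add_block_mx !subrr.
  by rewrite scale_block_mx !scaler0 !scaler_nat.
rewrite ones_Xeven; split=> [[r] | [a [c [-> ->]]]].
  (* With 2 written as [sqrt2 * sqrt2], one factor cancels; the other accounts for [s] in the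
     witnesses. *)
  rewrite -(vsubmxK r) -scalemxAr mul_col_row !mulmx0 -sqrt2_sqr -scalerA.
  move/(scalerI sqrt2_neq0); rewrite scale_block_mx => /eq_block_mx[EA _ EC _].
  exists (s *: usubmx r), (s *: dsubmx r).
  by rewrite -!scalemxAl -EA -EC !scalerA mulVf ?sqrt2_neq0 ?scale1r.
exists (sqrt2 R *: col_mx a c).
by rewrite -scalemxAl -scalemxAr mul_col_row !mulmx0 scalerA sqrt2_sqr.
Qed.

(** * Odd size: the conjugating matrix and the admissible blocks *)

Lemma Xodd_sqr : Xodd R nu *m Xodd R nu = 1%:M.
Proof.
rewrite /Xodd mul_block3.
rewrite !(mul0mx, mulmx0, mul1mx, mulmx1, addr0, add0r, mulmxN, mulNmx, opprK).
rewrite -!(scalemxAl, scalemxAr) !scalerA !(mul1mx, mulmx1) Jmx_mul.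
rewrite -scalerDl invsqrt2_sqr scale1r subrr.
by rewrite /block3_mx row_mx0 col_mx0 -!scalar_mx_block.
Qed.

Lemma tr_Xodd : (Xodd R nu)^T = Xodd R nu.
Proof.
by rewrite /Xodd tr_block3 !linearN !linearZ /= !trmx0 !trmx1 Jmx_tr.
Qed.

(** The middle column of [Xodd] is the unit vector at the index fixed by the reversal, hence
    symmetric, with eigenvalue 1. *)
Lemma Jmx_Xodd :
  Jmx R (nu + (1 + nu)) *m Xodd R nu =
  Xodd R nu *m block3_mx 1%:M 0 0 0 1%:M 0 0 0 (- 1%:M).
Proof.
rewrite Jmx_odd /J /Xodd !mul_block3 -!(scalemxAl, scalemxAr).
by rewrite !(mul1mx, mulmx1, mulmxN, mulNmx, opprK, mul0mx, mulmx0,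
  add0r, addr0, oppr0) -!(scalemxAl, scalemxAr) Jmx_mul
  !(scaler0, scalerN, add0r, addr0, mulmx1).
Qed.

Lemma ones_Xodd :
  (ones R (nu + (1 + nu)))^T *m Xodd R nu =
  row_mx (sqrt2 R *: (ones R nu)^T) (row_mx 1%:M 0).
Proof.
have E : s + s = sqrt2 R.
  by rewrite -mulr2n -mulr_natl -sqrt2_sqr mulfK ?sqrt2_neq0.
have one1 : (ones R 1)^T = 1%:M.
  by apply/matrixP => i j; rewrite !ord1 !mxE.
rewrite !ones_add !tr_col_mx /Xodd /block3_mx mul_row_block mul_mx_row.
rewrite mul_row_block mul_row_col !(mulmx0, mulmx1, add0r, addr0, mulmxN).
rewrite -!scalemxAr !mulmx1 ones_tr_Jmx one1 add_row_mx -scalerDl E.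
by rewrite add0r subrr.
Qed.

(** The row multiplying [r] has middle entry 1, so [r] must be twice the middle block column.
    Eliminating it ties the left block column to the middle one; the last stays free. *)
Lemma odd_shape (A11 A13 A31 A33 : 'M[R]_nu) (A12 A32 : 'cV[R]_nu)
    (A21 A23 : 'rV[R]_nu) (A22 : 'M[R]_1) :
  (exists r : 'cV[R]_(nu + (1 + nu)),
     block3_mx A11 A12 A13 A21 A22 A23 A31 A32 A33
     *m (1%:M + block3_mx 1%:M 0 0 0 1%:M 0 0 0 (- 1%:M)) =
     r *m ((ones R (nu + (1 + nu)))^T *m Xodd R nu)) <->
  [/\ A11 = sqrt2 R *: (A12 *m (ones R nu)^T),
      A21 = sqrt2 R *: (A22 *m (ones R nu)^T) &
      A31 = sqrt2 R *: (A32 *m (ones R nu)^T)].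
Proof.
have -> : block3_mx A11 A12 A13 A21 A22 A23 A31 A32 A33
     *m (1%:M + block3_mx 1%:M 0 0 0 1%:M 0 0 0 (- 1%:M)) =
  block3_mx (2 *: A11) (2 *: A12) 0 (2 *: A21) (2 *: A22) 0
            (2 *: A31) (2 *: A32) 0.
  rewrite mulmxDr mulmx1 mul_block3.
  rewrite !(mulmx1, mulmx0, mulmxN, addr0, add0r) /block3_mx.
  by rewrite !(add_block_mx, add_row_mx, add_col_mx) !subrr !scaler_nat.
have prod (r1 r3 : 'cV[R]_nu) (r2 : 'cV[R]_1) :
    col_mx r1 (col_mx r2 r3) *m row_mx (sqrt2 R *: (ones R nu)^T) (row_mx 1%:M 0)
    = block3_mx (sqrt2 R *: (r1 *m (ones R nu)^T)) r1 0
                (sqrt2 R *: (r2 *m (ones R nu)^T)) r2 0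
                (sqrt2 R *: (r3 *m (ones R nu)^T)) r3 0.
  rewrite mul_col_row mul_col_row mul_mx_row mul_col_mx /block3_mx.
  by rewrite !mulmx1 !mulmx0 -!scalemxAr.
have n2 : (2 : R) != 0 by rewrite pnatr_eq0.
rewrite ones_Xodd; split=> [[r] | [-> -> ->]].
  rewrite -(vsubmxK r) -(vsubmxK (dsubmx r)) prod.
  move/eq_block3_mx => [[E1 F1 _] [[E2 F2 _] [E3 F3 _]]].
  by split; apply: (scalerI n2); rewrite (E1, E2, E3) -(F1, F2, F3);
    rewrite -!scalemxAl !scalerA mulrC.
exists (col_mx (2 *: A12) (col_mx (2 *: A22) (2 *: A32))).
by rewrite prod -!scalemxAl !scalerA [2 * _]mulrC.
Qed.

End RowPairs.

(** * Combining the row and column constraints on the blocks *)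

Theorem theorem11 (R : realType) (nu : nat) :
  (forall M : 'M[R]_(nu + nu),
     in_Rn M <->
     exists (Z : 'M[R]_nu) (x z : 'cV[R]_nu) (gamma : R),
       M = Xeven R nu
           *m block_mx (gamma *: Emx R nu)      (ones R nu *m z^T)
                       (x *m (ones R nu)^T)     Z
           *m Xeven R nu) /\
  (forall M : 'M[R]_(nu + (1 + nu)),
     in_Rn M <->
     exists (Z : 'M[R]_nu) (x z : 'cV[R]_nu) (gamma : R),
       M = Xodd R nu
           *m block3_mx
                ((sqrt2 R * gamma) *: Emx R nu)
                (gamma *: ones R nu)
                (sqrt2 R *: (ones R nu *m z^T))
                (gamma *: (ones R nu)^T)
                (gamma / sqrt2 R)%:M
                z^T
                (sqrt2 R *: (x *m (ones R nu)^T))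
                x
                Z
           *m Xodd R nu).
Proof.
split=> M.
- set N := Xeven R nu *m M *m Xeven R nu.
  rewrite (in_Rn_conj (Xeven_sqr R nu) (tr_Xeven R nu) (Jmx_Xeven R nu) (erefl N)).
  rewrite -(submxK N) tr_block_mx !even_shape.
  (* The condition on [N] describes the left blocks through [a] and [x]; that on [N^T] describes the
     upper blocks through [a'] and [z]. *)
  split=> [[[a [x [Ea Ex]]] [a' [z [Ea' Ez]]]] | [Z [x [z [g]]]]]; last first.
    move/(conj_involutive _ _ (Xeven_sqr R nu)); rewrite -/N => ->.
    rewrite !(block_mxKul, block_mxKur, block_mxKdl).
    have E : g *: Emx R nu = (g *: ones R nu) *m (ones R nu)^T.
      by apply/matrixP => i j; rewrite mulmx_ones_tr !mxE.
    have tE : (Emx R nu)^T = Emx R nu by rewrite trmx_const.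
    split; first by exists (g *: ones R nu), x.
    exists (g *: ones R nu), z; split; first by rewrite linearZ /= tE E.
    by rewrite trmx_mul trmxK.
  (* By [Ea] an entry depends only on its row, by [Ea'] only on its column, so the block is
     constant. *)
  have [g Eg] : exists g, ulsubmx N = g *: Emx R nu.
    have entry i j : ulsubmx N i j = a i 0 by rewrite Ea mulmx_ones_tr.
    have entry' i j : ulsubmx N i j = a' j 0.
      by have := mulmx_ones_tr a' j i; rewrite -Ea' mxE.
    have [i0 _ | noI] := pickP (fun _ : 'I_nu => true).
      exists (a i0 0); apply/matrixP => i j.
      by rewrite entry' -(entry' i0 j) entry !mxE mulr1.
    (* For [nu = 0] the block is empty and has no entry from which to read [g]. *)
    by exists 0; apply/matrixP => i; have := noI i.
  exists (drsubmx N), x, z, g.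
  apply/(conj_involutive _ _ (Xeven_sqr R nu)); rewrite -/N -Eg -Ex.
  (* [Ez] concerns the transposed upper right block, hence the double transposition. *)
  by rewrite -[ones R nu *m _]trmxK trmx_mul trmxK -Ez trmxK submxK.
- have [N11 [N12 [N13 [N21 [N22 [N23 [N31 [N32 [N33 EN]]]]]]]]] :=
    block3_mx_exists (Xodd R nu *m M *m Xodd R nu).
  rewrite (in_Rn_conj (Xodd_sqr R nu) (tr_Xodd R nu) (Jmx_Xodd R nu) EN).
  rewrite tr_block3 !odd_shape.
  split=> [[[E11 E21 E31] [_ F12 F13]] | [Z [x [z [g]]]]]; last first.
    move/(conj_involutive _ _ (Xodd_sqr R nu)); rewrite EN.
    move=> /eq_block3_mx[[-> -> ->] [[-> -> ->] [-> -> _]]].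
    (* Used where the central block determines its left and upper neighbours. *)
    have rt : sqrt2 R * (g / sqrt2 R) = g by rewrite mulrC divfK ?sqrt2_neq0.
    by split; split; apply/matrixP => i j; rewrite [RHS]mxE mulmx_ones_tr
      ?mxE ?big_ord1 ?mxE ?ord1 ?eqxx ?mulr1 ?mul1r ?rt.
  (* The central entry exists for every [nu] and must equal [g / sqrt2], which fixes [g]. From it,
     [F12] and [E21] give the neighbouring blocks [N12] and [N21], and [E11] then gives the
     corner. *)
  pose g := sqrt2 R * N22 0 0.
  exists N33, N32, N23^T, g.
  apply/(conj_involutive _ _ (Xodd_sqr R nu)); rewrite EN.
  have F22 : (g / sqrt2 R)%:M = N22.
    by rewrite /g mulrAC divff ?sqrt2_neq0 // mul1r -mx11_scalar.
  have F12' : N12 = g *: ones R nu.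
    apply/matrixP => i j; rewrite -[N12]trmxK F12 ord1.
    by rewrite mxE [LHS]mxE mulmx_ones_tr !mxE mulr1.
  have F11 : N11 = (sqrt2 R * g) *: Emx R nu.
    by apply/matrixP => i j; rewrite E11 F12' [LHS]mxE mulmx_ones_tr !mxE !mulr1.
  have F21 : N21 = g *: (ones R nu)^T.
    apply/matrixP => i j; rewrite E21 [LHS]mxE mulmx_ones_tr !mxE mulr1.
    by rewrite ord1.
  have F13' : N13 = sqrt2 R *: (ones R nu *m (N23^T)^T).
    by rewrite -[N13]trmxK F13 linearZ /= trmx_mul !trmxK.
  by rewrite F22 -F12' -F11 -F21 -F13' trmxK -E31.
Qed.
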